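(* Let $X$ and $Y$ be perfectly normal Hausdorff spaces, $\mu\in\mathcal{P}_r(X)$, $\nu\in\mathcal{P}_r(Y)$ Radon probability measures, and $c\in lsc_{bi}(X\times Y)$ with $v_{\min}(\mathbf{KP})<+\infty$. Suppose $c(x,y)=\lim_{n\to\infty}c_n(x,y)$ for all $(x,y)\in X\times Y$, where $(c_n)_{n\in\mathbb{N}}$ is a pointwise nondecreasing sequence of bounded non-negative functions $c_n:X\times Y\to\mathbb{R}$ each having property (H). Then $v_{\max}(\mathbf{DP})=v_{\min}(\mathbf{KP})$.
   Context: $C_b(Z)$: real-valued bounded continuous functions on $Z$. $lsc_{bi}(Z)$: proper (not identically $+\infty$), bounded-below, lower semicontinuous $g:Z\to\mathbb{R}\cup\{+\infty\}$. Radon probability measures: Borel probability measures inner regular with respect to compact sets; $\mathcal{P}_r$ denotes them. $(\phi\oplus\psi)(x,y):=\phi(x)+\psi(y)$. $\Pi(\mu,\nu)$: Radon probability measures on $X\times Y$ with marginals $\mu$ and $\nu$; $v_{\min}(\mathbf{KP}):=\inf\{\int c\,d\gamma:\gamma\in\Pi(\mu,\nu)\}$; $v_{\max}(\mathbf{DP}):=\sup\{\int\phi\,d\mu+\int\psi\,d\nu:\phi\in C_b(X),\psi\in C_b(Y),\phi\oplus\psi\le c\}$. For a function $f:X\times Y\to\mathbb{R}$, with $\overline{d}_f(x,x'):=\sup_y|f(x,y)-f(x',y)|$ and $\underline{d}_f(y,y'):=\sup_x|f(x,y)-f(x,y')|$, property (H) means $\lim_{x\to x_0}\overline{d}_f(x,x_0)=0$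 for all $x_0\in X$ and $\lim_{y\to y_0}\underline{d}_f(y,y_0)=0$ for all $y_0\in Y$. *)

(* Defs.v *)
From HB Require Import structures.
From mathcomp Require Import all_boot all_order all_algebra.
From mathcomp Require Import all_classical all_reals all_analysis.
Set Implicit Arguments. Unset Strict Implicit. Unset Printing Implicit Defensive.
Import Order.TTheory GRing.Theory Num.Theory.
Import numFieldNormedType.Exports.
Local Open Scope classical_set_scope.
Local Open Scope ring_scope.

(* The product of two pointed topological spaces, with the product topology,
   as a pointed topological space (joins the existing instances). *)
HB.instance Definition _ (X Y : ptopologicalType) := Pointed.on (X * Y)%type.

Definition borel (T : ptopologicalType) := g_sigma_algebraType (@open T).

Definition perfectly_normal (T : topologicalType) :=
  normal_space T /\
  forall A : set T, closed A ->
    exists U : nat -> set T, (forall n, open (U n)) /\ A = \bigcap_n U n.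

Definition radon (T : ptopologicalType) (R : realType)
    (mu : set (borel T) -> \bar R) :=
  forall A : set (borel T), measurable A ->
    mu A = ereal_sup [set mu K | K in
      [set K : set (borel T) | @compact T K /\ K `<=` A]].

Definition Cb (T : topologicalType) (R : realType) (f : T -> R) :=
  continuous f /\ exists M : R, forall x, `|f x| <= M.

Definition lsc_bi (Z : topologicalType) (R : realType) (g : Z -> \bar R) :=
  [/\ lower_semicontinuous g,
      (exists z, g z != +oo%E) &
      (exists M : R, forall z, (M%:E <= g z)%E)].

Definition coupling (X Y : ptopologicalType) (R : realType)
    (mu : probability (borel X) R) (nu : probability (borel Y) R)
    (g : probability (borel (X * Y)%type) R) :=
  [/\ radon g,
      (forall A : set (borel X), measurable A ->
          g (A `*` setT : set (borel (X * Y)%type)) = mu A) &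
      (forall B : set (borel Y), measurable B ->
          g (setT `*` B : set (borel (X * Y)%type)) = nu B)].

Definition vKP (X Y : ptopologicalType) (R : realType)
    (mu : probability (borel X) R) (nu : probability (borel Y) R)
    (c : X * Y -> \bar R) : \bar R :=
  ereal_inf [set (\int[g]_z c z)%E | g in [set g | coupling mu nu g]].

Definition vDP (X Y : ptopologicalType) (R : realType)
    (mu : probability (borel X) R) (nu : probability (borel Y) R)
    (c : X * Y -> \bar R) : \bar R :=
  ereal_sup [set (\int[mu]_x (pp.1 x)%:E + \int[nu]_y (pp.2 y)%:E)%E
    | pp in [set pp : (X -> R) * (Y -> R) |
        [/\ Cb pp.1, Cb pp.2 &
            forall x y, ((pp.1 x + pp.2 y)%:E <= c (x, y))%E]]].

Definition dbar (X Y : topologicalType) (R : realType) (f : X * Y -> R)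
    (x x' : X) : \bar R :=
  ereal_sup [set (`|f (x, y) - f (x', y)|)%:E | y in [set: Y]].
Definition dunder (X Y : topologicalType) (R : realType) (f : X * Y -> R)
    (y y' : Y) : \bar R :=
  ereal_sup [set (`|f (x, y) - f (x, y')|)%:E | x in [set: X]].

Definition propH (X Y : topologicalType) (R : realType) (f : X * Y -> R) :=
  (forall x0 : X, dbar f x x0 @[x --> x0] --> 0%E) /\
  (forall y0 : Y, dunder f y y0 @[y --> y0] --> 0%E).

(* Main.v *)
Require Import Defs.
From HB Require Import structures.
From mathcomp Require Import all_boot all_order all_algebra.
From mathcomp Require Import all_classical all_reals all_analysis.
From mathcomp Require Import measurable_realfun ring lra.
Import Order.TTheory GRing.Theory Num.Theory.
Import numFieldNormedType.Exports.
Local Open Scope classical_set_scope.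
Local Open Scope ring_scope.

(* Weak duality is integration of [phi (+) psi <= c] against a coupling.  For
   the converse put [D := vDP mu nu c].  By property (H), c-transforms of bounded
   Borel potentials are continuous and bounded, so bounded Borel potentials below
   some [cn n] also have dual value at most [D].  Hence, by Hahn-Banach, there is
   a positive linear functional [L] on all bounded functions on [X * Y] that has
   marginals [mu] and [nu] and satisfies [L (cn n) <= D] for every [n] at once.
   The finitely additive [E |-> L \1_E] is tight because [mu] and [nu] are, and
   its inner regularization over compact sets, which is smaller on open sets, is
   a Radon coupling [g].  Slicing [cn n] into its open superlevel sets gives
   [\int[g] cn n <= L (cn n) <= D], and monotone convergence gives
   [\int[g] c <= D]. *)

(** * Minimal sublinear functionals *)

Section MinimalSublinear.
Context {R : realType} {V : lmodType R} (B : set V).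
Hypothesis BD : forall x y, B x -> B y -> B (x + y).
Hypothesis BZ : forall (t : R) x, B x -> B (t *: x).

(** Homogeneity is asked only as an inequality, which passes easily to infima; applied also to
    [t^-1] it becomes the equality [sublinear_scale]. Everything is relative to [B] because prices
    are real-valued [inf]s, meaningful on bounded functions only. *)
Definition sublinear_on (q : V -> R) :=
  (forall x y, B x -> B y -> q (x + y) <= q x + q y) /\
  (forall (t : R) x, 0 < t -> B x -> q (t *: x) <= t * q x).

Lemma sublinear_scale q (t : R) x : sublinear_on q -> 0 < t -> B x ->
  q (t *: x) = t * q x.
Proof.
move=> [_ qZ] t0 Bx; apply/eqP; rewrite eq_le qZ//=.
have ti0 : 0 < t^-1 by rewrite invr_gt0.
have := qZ _ _ ti0 (BZ t x Bx); rewrite scalerA mulVf ?gt_eqF// scale1r.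
by rewrite mulrC ler_pdivlMr// mulrC.
Qed.

Lemma sublinear0 q : sublinear_on q -> B 0 -> q 0 = 0.
Proof.
move=> sq B0; have := sublinear_scale q 2 0 sq ltac:(lra) B0.
rewrite scaler0 => ?; lra.
Qed.

Lemma sublinear_geN q x : sublinear_on q -> B x -> - q (- x) <= q x.
Proof.
move=> sq Bx; have BNx : B (- x) by rewrite -scaleN1r; exact: BZ.
have B0 : B 0 by rewrite -(subrr x); exact: BD.
have := sq.1 x (- x) Bx BNx; rewrite subrr (sublinear0 q)// => ?; lra.
Qed.

Let dominates (q r : V -> R) := forall x, B x -> r x <= q x.

Variable p : V -> R.
Hypothesis sp : sublinear_on p.

Let below := {q : V -> R | sublinear_on q /\ dominates p q}.

(** The chain condition for Zorn's lemma. The lower bound [- p (- x)] keeps the infima finite.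
    Subadditivity uses totality: of two members of the chain, the smaller one lies below both. *)
Lemma chain_inf_sublinear (A : set below) (a0 : below) : A a0 ->
    total_on A (fun s t => dominates (sval s) (sval t)) ->
  let q := fun x => inf [set sval a x | a in A] in
  [/\ sublinear_on q, dominates p q & forall a, A a -> dominates (sval a) q].
Proof.
move=> Aa0 tA q.
have lbA x : B x -> has_lbound [set sval a x | a in A].
  move=> Bx; exists (- p (- x)) => _ [a _ <-].
  have [sa pa] := svalP a.
  have BNx : B (- x) by rewrite -scaleN1r; exact: BZ.
  by apply: le_trans (sublinear_geN _ _ sa Bx); rewrite lerN2; exact: pa.
have qle a x : A a -> B x -> q x <= sval a x.
  by move=> Aa Bx; apply: ge_inf; [exact: lbA|exists a].
have qge x r : (forall a, A a -> r <= sval a x) -> r <= q x.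
  move=> rA; apply: lb_le_inf; first by exists (sval a0 x), a0.
  by move=> _ [a Aa <-]; exact: rA.
split; [split| |].
- move=> x y Bx By; rewrite -lerBlDr; apply: (qge) => a Aa.
  rewrite lerBlDr -lerBlDl; apply: (qge) => b Ab.
  rewrite lerBlDl.
  have := tA a b Aa Ab; case=> [ab|ba].
    apply: le_trans (qle _ _ Ab (BD _ _ Bx By)) _.
    apply: le_trans ((svalP b).1.1 _ _ Bx By) _.
    by rewrite lerD2r; exact: ab.
  apply: le_trans (qle _ _ Aa (BD _ _ Bx By)) _.
  apply: le_trans ((svalP a).1.1 _ _ Bx By) _.
  by rewrite lerD2l; exact: ba.
- move=> t x t0 Bx; rewrite mulrC -ler_pdivrMr//; apply: (qge) => a Aa.
  rewrite ler_pdivrMr// mulrC.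
  by apply: le_trans (qle _ _ Aa (BZ _ _ Bx)) _; exact: (svalP a).1.2.
- by move=> x Bx; apply: le_trans (qle _ _ Aa0 Bx) _; exact: (svalP a0).2.
- by move=> a Aa x Bx; exact: qle.
Qed.

(* Hahn-Banach without extending partial functionals: a sublinear functional
   that is minimal below [p] is additive, because lowering [q] in the direction
   [y], to [x |-> inf_(t >= 0) (q (x + t y) - t q y)], cannot decrease it. *)
Theorem exists_additive_below : exists L : V -> R,
  [/\ sublinear_on L, (forall x, B x -> L x <= p x) &
      forall x y, B x -> B y -> L (x + y) = L x + L y].
Proof.
(* The order is reversed, so a maximal element is a minimal functional. It is only a preorder, since
   values off [B] are not compared. *)
have [||A tA|[q [sq pq]] qmin] := @ZL_preorder below
    (exist _ p (conj sp (fun x _ => lexx (p x))))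
    (fun s t => `[< dominates (sval s) (sval t) >]).
- by move=> t; apply/asboolP => x _.
- move=> r s t /asboolP rs /asboolP st; apply/asboolP => x Bx.
  by apply: le_trans (st x Bx) _; exact: rs.
- have [[a0 Aa0]|A0] := pselect (exists a, A a).
    have tA' : total_on A (fun s t => dominates (sval s) (sval t)).
      by move=> s t As At; have [/asboolP|/asboolP] := tA s t As At; [left|right].
    have [sq pq qA] := chain_inf_sublinear _ _ Aa0 tA'.
    exists (exist (fun q => sublinear_on q /\ dominates p q) _ (conj sq pq)).
    by move=> s As; apply/asboolP; exact: qA.
  exists (exist _ p (conj sp (fun x _ => lexx (p x)))) => s As.
  by exfalso; apply: A0; exists s.
exists q; split=> // x y Bx By.
apply/eqP; rewrite eq_le sq.1//=.
pose S z := [set q (z + t *: y) - t * q y | t in [set t : R | 0 <= t]].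
pose r z := inf (S z).
have B0 : B 0 by rewrite -(subrr y) -scaleN1r; apply: BD => //; exact: BZ.
have q0 : q 0 = 0 by exact: sublinear0.
have qZ t z : 0 <= t -> B z -> q (t *: z) = t * q z.
  rewrite le_eqVlt => /predU1P[<-|t0] Bz; first by rewrite scale0r mul0r.
  exact: sublinear_scale.
have Sn z : S z !=set0 by exists (q (z + 0 *: y) - 0 * q y), 0 => /=.
have rge z m : (forall t, 0 <= t -> m <= q (z + t *: y) - t * q y) -> m <= r z.
  by move=> mS; apply: lb_le_inf => // _ [t /= t0 <-]; exact: mS.
have Slb z : B z -> has_lbound (S z).
  move=> Bz; exists (- q (- z)) => _ [t /= t0 <-].
  have BNz : B (- z) by rewrite -scaleN1r; exact: BZ.
  have := sq.1 _ _ (BD _ _ Bz (BZ t _ By)) BNz.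
  by rewrite addrC addrA addNr add0r qZ// => ?; lra.
have rle z t : 0 <= t -> B z -> r z <= q (z + t *: y) - t * q y.
  by move=> t0 Bz; apply: ge_inf; [exact: Slb|exists t].
have rq z : B z -> r z <= q z.
  by move=> Bz; have := rle z 0 (lexx _) Bz; rewrite scale0r addr0 mul0r subr0.
have sr : sublinear_on r.
  split=> [u v Bu Bv|t u t0 Bu].
    rewrite -lerBlDr; apply: (rge) => s s0.
    rewrite lerBlDr -lerBlDl; apply: (rge) => t t0.
    rewrite lerBlDl; have := rle _ _ (addr_ge0 s0 t0) (BD _ _ Bu Bv).
    have := sq.1 _ _ (BD _ _ Bu (BZ s _ By)) (BD _ _ Bv (BZ t _ By)).
    by rewrite addrACA -scalerDl => ? ?; lra.
  rewrite mulrC -ler_pdivrMr//; apply: (rge) => s s0.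
  rewrite ler_pdivrMr//; have := rle _ _ (mulr_ge0 (ltW t0) s0) (BZ t _ Bu).
  rewrite -scalerA -scalerDr (sublinear_scale q)//; last by apply: BD => //; exact: BZ.
  by move=> ?; lra.
have pr : dominates p r by move=> z Bz; apply: le_trans (rq _ Bz) _; exact: (pq).
(* Minimality gives [q x <= r x], and [t = 1] in the infimum defining [r x] gives
   [r x <= q (x + y) - q y]. *)
have /asboolP/(_ x Bx)/= qr := qmin (exist _ r (conj sr pr)) (asboolT rq).
have := rle x 1 ler01 Bx; rewrite scale1r => ?; lra.
Qed.

End MinimalSublinear.

(** * Hahn-Banach for superreplication prices *)

Section PricedFunctionals.
Context {R : realType} {Z : pointedType}.

Definition bdd (f : Z -> R) := exists M : R, forall z, `|f z| <= M.

Lemma bddD f g : bdd f -> bdd g -> bdd (f + g).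
Proof.
move=> [M fM] [N gN]; exists (M + N) => z.
by apply: le_trans (ler_normD _ _) _; exact: lerD.
Qed.

Lemma bddZ t f : bdd f -> bdd (t *: f).
Proof.
move=> [M fM]; exists (`|t| * M) => z.
by rewrite normrM; apply: ler_wpM2l.
Qed.

Lemma bdd_cst (M : R) : bdd (cst M).
Proof. by exists `|M|. Qed.

Lemma bdd_indic (E : set Z) : bdd (\1_E : Z -> R).
Proof.
by exists 1 => z; rewrite indicE; case: (_ \in _); rewrite ?normr1 ?normr0.
Qed.

(* [C h r] reads: the payoff [h] can be superreplicated at price [r]. *)
Theorem exists_pricing (C : (Z -> R) -> R -> Prop)
  (CD : forall h k r s, C h r -> C k s -> C (h + k) (r + s))
  (CZ : forall (t : R) h r, 0 < t -> C h r -> C (t *: h) (t * r))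
  (Cle : forall h k r, (forall z, h z <= k z) -> C k r -> C h r)
  (C1 : forall M : R, C (cst M) M)
  (C0 : forall r, C (cst 0) r -> 0 <= r) :
  exists L : (Z -> R) -> R,
    [/\ forall h k, bdd h -> bdd k -> L (h + k) = L h + L k,
        forall (t : R) h, 0 <= t -> bdd h -> L (t *: h) = t * L h &
        forall h r, bdd h -> C h r -> L h <= r].
Proof.
pose p h := inf [set r | C h r].
have pn h : bdd h -> [set r | C h r] !=set0.
  move=> [M hM]; exists M; apply: Cle (C1 M) => z.
  by apply: le_trans (hM z); exact: ler_norm.
have plb h : bdd h -> has_lbound [set r | C h r].
  (* Since [0 <= h + M] and [h + M] can be had at price [r + M], [C0] forces [- M <= r]. *)
  move=> [M hM]; exists (- M) => r /= Chr.
  rewrite -subr_ge0 opprK; apply: C0; apply: Cle (CD _ _ _ _ Chr (C1 M)) => z /=.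
  rewrite /= -[(h + cst M) z]/(h z + M) -lerBlDr sub0r lerNl.
  by apply: le_trans (hM z); rewrite -normrN ler_norm.
have ple h r : bdd h -> C h r -> p h <= r.
  by move=> bh Chr; apply: ge_inf => //; exact: plb.
have pge h m : bdd h -> (forall r, C h r -> m <= r) -> m <= p h.
  by move=> bh mC; apply: lb_le_inf; [exact: pn|].
have sp : sublinear_on bdd p.
  split=> [h k bh bk|t h t0 bh].
    rewrite -lerBlDr; apply: (pge) => // r Chr.
    rewrite lerBlDr -lerBlDl; apply: (pge) => // s Cks.
    by rewrite lerBlDl; apply: ple (bddD _ _ bh bk) (CD _ _ _ _ Chr Cks).
  rewrite mulrC -ler_pdivrMr//; apply: (pge) => // r Chr.
  by rewrite ler_pdivrMr// mulrC; apply: ple (bddZ _ _ bh) (CZ _ _ _ t0 Chr).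
have [L [sL Lp LD]] := exists_additive_below bdd bddD bddZ p sp.
exists L; split=> // [t h|h r bh Chr].
  rewrite le_eqVlt => /predU1P[<-|t0] bh.
    by rewrite scale0r mul0r; apply: (sublinear0 bdd bddZ) => //; exact: bdd_cst.
  exact: (sublinear_scale bdd bddZ).
by apply: le_trans (Lp _ bh) _; exact: ple.
Qed.

End PricedFunctionals.

(** * Radon measures from tight contents *)

Section HausdorffCompact.
Context {Z : ptopologicalType}.

(** Near-covering compactness against the filter of small members of [F] replaces the choice of a
    finite subcover. A general [F] allows two uses: neighbourhoods of a point and neighbourhoods of
    a compact set. *)
Lemma compact_filter_separated (F : set_system Z) (B : set Z) :
  ProperFilter F -> compact B ->
  (forall b, B b -> exists V W, [/\ nbhs b V, F W & V `&` W = set0]) ->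
  exists2 W, F W & closure W `&` B = set0.
Proof.
move=> FF /compact_near_coveringP cB sepB.
have := cB _ (powerset_filter_from F) (fun W b => ~ closure W b) _.
case=> [b Bb|Q [QF _ [W QW]] WB].
- have [V [W [Vb FW VW]]] := sepB b Bb.
  near=> b' W' => /=.
  have W'W : W' `<=` W by near: W'; exact: small_set_sub.
  move/(_ V); have : nbhs b' V by near: b'; exact: nbhs_interior.
  move=> /[swap] /[apply] -[x [/W'W Wx Vx]].
  by have : (V `&` W) x by []; rewrite VW.
exists W; first exact: QF.
by rewrite -subset0 => x [cx Bx]; exact: WB QW _ Bx cx.
Unshelve. all: by end_near. Qed.

Hypothesis hZ : hausdorff_space Z.

(** Two rounds of [compact_filter_separated]: each point of [B] is separated from [A], then [A] as a
    whole from [B]. *)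
Lemma compact_separated (A B : set Z) : compact A -> compact B ->
  A `&` B = set0 ->
  exists U V, [/\ open U, open V, A `<=` U, B `<=` V & U `&` V = set0].
Proof.
move=> cA cB AB.
(* The neighbourhoods of the empty set do not form a proper filter. *)
have [A0|/set0P A0] := eqVneq A set0.
  exists set0, setT; split; rewrite ?A0 ?set0I//; first exact: open0.
  exact: topology_structure.openT.
have ptA b : B b -> exists V W, [/\ nbhs b V, set_nbhs A W & V `&` W = set0].
  move=> Bb; have [|V Vb VA] := compact_filter_separated (nbhs b) A _ cA.
    move=> a Aa; have ab : a != b.
      by apply/eqP => ab; rewrite -ab in Bb; have : (A `&` B) a by []; rewrite AB.
    have := hZ; rewrite open_hausdorff => /(_ _ _ ab)[[V W]/= [Va Wb] [oV oW VW]].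
    exists V, W; split.
    - by apply: open_nbhs_nbhs; split=> //; rewrite -in_setE.
    - by apply: open_nbhs_nbhs; split=> //; rewrite -in_setE.
    - by apply/eqP.
  exists V, (~` closure V); split=> //.
    move=> a Aa; apply: open_nbhs_nbhs; split.
      exact/closed_openC/closed_closure.
    by move=> ca; have : (closure V `&` A) a by []; rewrite VA.
  by rewrite -subset0 => x [Vx]; apply; exact: subset_closure.
have [W nAW WB] := compact_filter_separated _ B (set_nbhs_pfilter A0) cB ptA.
exists W°, (~` closure W); split=> //.
- exact: open_interior.
- exact/closed_openC/closed_closure.
- by move=> b Bb cb; have : (closure W `&` B) b by []; rewrite WB.
- rewrite -subset0 => x [/interior_subset Wx]; apply; exact: subset_closure.
Qed.

(** The compact sets [K \ U] and [K \ V] are disjoint. Removing from [K] disjoint open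
    neighbourhoods of them, one at a time, leaves compact pieces inside [U] and [V] that still cover
    [K]. *)
Lemma compact_split (K U V : set Z) : compact K -> open U -> open V ->
  K `<=` U `|` V ->
  exists K1 K2, [/\ compact K1, compact K2, K1 `<=` U, K2 `<=` V &
    K = K1 `|` K2].
Proof.
move=> cK oU oV KUV.
have cD W : open W -> compact (K `\` W).
  move=> oW; apply: (subclosed_compact _ cK) => [|x []//].
  by apply: closedI; [exact: compact_closed|exact: open_closedC].
have [|U' [V' [oU' oV' KU KV UV]]] := compact_separated _ _ (cD _ oU) (cD _ oV).
  by rewrite -subset0 => x [[Kx Ux] [_ Vx]]; case: (KUV x Kx).
exists (K `\` U'), (K `\` V'); split; try exact: cD.
- by move=> x [Kx U'x]; apply: contrapT => Ux; apply: U'x; exact: KU.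
- by move=> x [Kx V'x]; apply: contrapT => Vx; apply: V'x; exact: KV.
- rewrite -setDIr UV setD0//.
Qed.

Lemma compact_sub_bigcup (K : set Z) (U : nat -> set Z) : compact K ->
  (forall i, open (U i)) -> K `<=` \bigcup_i U i ->
  exists n, K `<=` \big[setU/set0]_(i < n) U i.
Proof.
move=> cK oU KU; move: cK; rewrite compact_cover.
move=> /(_ nat setT U (fun i _ => oU i) KU)[D _ KD].
(* The largest index of a finite subcover, plus one because the union runs over [i < n]. *)
exists (\max_(i <- finmap.enum_fset D) i).+1 => x /KD[i /= Di Uix].
rewrite -bigcup_mkord; exists i => //=.
by rewrite ltnS; exact: (@leq_bigmax_seq _ (finmap.enum_fset D) predT id i).
Qed.

End HausdorffCompact.

Lemma measurable_open_borel (T : ptopologicalType) (U : set T) : open U ->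
  measurable (U : set (borel T)).
Proof. by move=> oU; exact: sub_gen_smallest. Qed.

Lemma measurable_closed_borel (T : ptopologicalType) (A : set T) : closed A ->
  measurable (A : set (borel T)).
Proof.
move=> cA; rewrite -(setCK A); apply: measurableC; apply: measurable_open_borel.
exact: closed_openC.
Qed.

(** * The outer measure induced by a tight content *)

Section TightContent.
Context {R : realType} {Z : ptopologicalType}.
Hypothesis hZ : hausdorff_space Z.
Variable ga : set Z -> R.
Hypothesis ga_ge0 : forall A, 0 <= ga A.
Hypothesis gaD : forall A B, A `&` B = set0 -> ga (A `|` B) = ga A + ga B.
Hypothesis gaT : ga setT = 1.
Hypothesis ga_tight : forall e : R, 0 < e ->
  exists2 K, compact K & ga (~` K) <= e.

Lemma content0 : ga set0 = 0.
Proof. by have := gaD set0 set0 (setI0 _); rewrite setU0 => ?; lra. Qed.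

Lemma contentS A B : A `<=` B -> ga A <= ga B.
Proof.
move=> AB; rewrite -(setDUK AB) gaD ?setDIK//.
by have := ga_ge0 (B `\` A) => ?; lra.
Qed.

Lemma contentU A B : ga (A `|` B) <= ga A + ga B.
Proof.
rewrite -(setDUK (@subsetUl _ A B)) gaD ?setDIK// lerD2l.
by apply: contentS => x [[]].
Qed.

Local Open Scope ereal_scope.

(** The two stages by which Halmos turns a content into a regular outer measure: open sets are
    measured from inside by compact sets, then [outer_content] measures arbitrary sets from outside
    by open ones. *)
Definition inner_content (U : set Z) : \bar R :=
  ereal_sup [set (ga K)%:E | K in [set K | compact K /\ K `<=` U]].

Definition outer_content (A : set Z) : \bar R :=
  ereal_inf [set inner_content U | U in [set U | open U /\ A `<=` U]].

Lemma inner_content_ub K U : compact K -> K `<=` U ->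
  (ga K)%:E <= inner_content U.
Proof. by move=> cK KU; apply: ereal_sup_ubound; exists K. Qed.

Lemma inner_contentS U V : U `<=` V -> inner_content U <= inner_content V.
Proof.
move=> UV; apply: ge_ereal_sup => _ [K [cK KU] <-].
by apply: inner_content_ub => //; exact: subset_trans UV.
Qed.

Lemma inner_content_ge0 U : 0 <= inner_content U.
Proof.
have -> : 0 = (ga set0)%:E by rewrite content0.
apply: inner_content_ub; first exact: compact0.
exact: sub0set.
Qed.

Lemma inner_content_le U : inner_content U <= (ga U)%:E.
Proof.
by apply: ge_ereal_sup => _ [K [cK KU] <-]; rewrite lee_fin; exact: contentS.
Qed.

Lemma inner_content_fin U : inner_content U \is a fin_num.
Proof.
rewrite ge0_fin_numE ?inner_content_ge0//.
by apply: le_lt_trans (inner_content_le U) _; rewrite ltry.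
Qed.

(** [compact_split] cuts a compact subset of the union into a compact part of each open set. *)
Lemma inner_contentU U V : open U -> open V ->
  inner_content (U `|` V) <= inner_content U + inner_content V.
Proof.
move=> oU oV; apply: ge_ereal_sup => _ [K [cK KUV] <-].
have [K1 [K2 [cK1 cK2 K1U K2V ->]]] := compact_split hZ _ _ _ cK oU oV KUV.
apply: (@le_trans _ _ ((ga K1)%:E + (ga K2)%:E)).
  by rewrite -EFinD lee_fin contentU.
by apply: leeD; exact: inner_content_ub.
Qed.

(** Each compact [K] meets the supremum through finitely many of the sets, so finite subadditivity
    suffices. *)
Lemma inner_content_bigcup (U : nat -> set Z) : (forall i, open (U i)) ->
  inner_content (\bigcup_i U i) <= \sum_(i <oo) inner_content (U i).
Proof.
move=> oU; apply: ge_ereal_sup => _ [K [cK KU] <-].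
have [n KUn] := compact_sub_bigcup _ _ cK oU KU.
apply: (@le_trans _ _ (\sum_(0 <= i < n) inner_content (U i))); last first.
  by apply: nneseries_lim_ge => i _ _; exact: inner_content_ge0.
apply: le_trans (inner_content_ub _ _ cK KUn) _.
elim: n {KUn} => [|n IH].
  rewrite big_ord0 big_nil; apply: le_trans (inner_content_le _) _.
  by rewrite content0.
rewrite big_ord_recr/= big_nat_recr//=; apply: le_trans (leeD2r _ IH).
apply: inner_contentU => //; rewrite -bigcup_mkord; exact: bigcup_open.
Qed.

Lemma outer_content_le A U : open U -> A `<=` U ->
  outer_content A <= inner_content U.
Proof. by move=> oU AU; apply: ereal_inf_lbound; exists U. Qed.

Lemma outer_content_open U : open U -> outer_content U = inner_content U.
Proof.
move=> oU; apply/eqP; rewrite eq_le outer_content_le//=.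
by apply: le_ereal_inf_tmp => _ [V [oV UV] <-]; exact: inner_contentS.
Qed.

Lemma outer_content_ge0 A : 0 <= outer_content A.
Proof. by apply: le_ereal_inf_tmp => _ [V _ <-]; exact: inner_content_ge0. Qed.

Lemma outer_content0 : outer_content set0 = 0.
Proof.
apply/eqP; rewrite eq_le outer_content_ge0 outer_content_open ?andbT; last exact: open0.
by apply: le_trans (inner_content_le _) _; rewrite content0.
Qed.

Lemma outer_contentS : {homo outer_content : A B / A `<=` B >-> A <= B}.
Proof.
move=> A B AB; apply: ereal_inf_le_tmp => _ [V [oV BV] <-].
by exists V => //; split=> //; exact: subset_trans BV.
Qed.

Lemma outer_content_fin A : outer_content A \is a fin_num.
Proof.
rewrite ge0_fin_numE ?outer_content_ge0//.
apply: le_lt_trans (outer_contentS _ _ (@subsetT _ A)) _.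
by rewrite outer_content_open ?ltey_eq ?inner_content_fin//; exact: topology_structure.openT.
Qed.

Lemma outer_content_adherent A (e : R) : (0 < e)%R ->
  exists U, [/\ open U, A `<=` U & inner_content U <= outer_content A + e%:E].
Proof.
move=> e0; have [_ [U [oU AU] <-] /ltW UA] :=
  lb_ereal_inf_adherent e0 (outer_content_fin A).
by exists U.
Qed.

Lemma outer_content_sigma_subadditive : sigma_subadditive outer_content.
Proof.
move=> F; apply/lee_addgt0Pr => e e0.
have e2 n : (0 < e / (2 ^ n.+1)%:R)%R by rewrite divr_gt0// ltr0n expn_gt0.
have /choice[U UP] := fun n => outer_content_adherent (F n) _ (e2 n).
apply: le_trans (epsilon_trick _ _ (ltW e0)); last first.
  by move=> n; exact: outer_content_ge0.
have oU n : open (U n) by case: (UP n).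
apply: (@le_trans _ _ (inner_content (\bigcup_n U n))).
  apply: outer_content_le; first exact: bigcup_open.
  by move=> x [n _ Fx]; exists n => //; have [_ FU _] := UP n; exact: FU.
apply: le_trans (inner_content_bigcup _ oU) _.
apply: lee_nneseries => [n _ _|n _]; first exact: inner_content_ge0.
by have [_ _] := UP n.
Qed.

HB.instance Definition _ := isOuterMeasure.Build R Z outer_content
  outer_content0 outer_content_ge0 outer_contentS outer_content_sigma_subadditive.

(* For open [U], [W], compact [K <= W /\ U] and compact [K' <= W \ K], finite
   additivity gives [ga K + ga K' <= inner_content W]. *)
Lemma open_caratheodory U : open U -> outer_content.-caratheodory U.
Proof.
move=> oU; apply: le_caratheodory_measurable => X.
apply/lee_addgt0Pr => e e0.
have e2 : (0 < e / 2)%R by lra.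
have [W [oW XW WX]] := outer_content_adherent X _ e2.
have := ub_ereal_sup_adherent e2 (inner_content_fin (W `&` U)).
rewrite -/(inner_content _) => -[_ [K [cK KWU] <-] /ltW Kge].
have WK : outer_content (X `&` ~` U) <= inner_content (W `\` K).
  apply: outer_content_le.
    by apply: openI => //; apply: closed_openC; exact: compact_closed.
  by move=> x [Xx Ux]; split; [exact: XW|move=> /KWU[]].
have WU : outer_content (X `&` U) <= inner_content (W `&` U).
  by apply: outer_content_le; [exact: openI|exact: setSI].
have KK : inner_content (W `\` K) <= inner_content W - (ga K)%:E.
  apply: ge_ereal_sup => _ [K' [cK' K'W] <-].
  rewrite leeBrDr// -EFinD -gaD.
    apply: inner_content_ub; first exact: compactU.
    by move=> x [/K'W[]|/KWU[]].
  by rewrite -subset0 => x [/K'W[]].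
change (outer_content (X `&` U) + outer_content (X `&` ~` U) <=
  outer_content X + e%:E).
(* All six values are finite, so the estimates add up over the reals: [ga K] cancels and the two
   errors [e / 2] make [e]. *)
have := inner_content_fin W; have := inner_content_fin (W `&` U).
have := outer_content_fin X; have := outer_content_fin (X `&` U).
have := outer_content_fin (X `&` ~` U); have := inner_content_fin (W `\` K).
move: WX Kge WK WU KK.
move: (inner_content W) (inner_content (W `&` U)) (inner_content (W `\` K)).
move: (outer_content X) (outer_content (X `&` U)) (outer_content (X `&` ~` U)).
move=> [x| |]// [y| |]// [z| |]// [u| |]// [v| |]// [w| |]//.
by rewrite -?EFinD -?EFinB !lee_fin => ? ? ? ? ? _ _ _ _ _ _; lra.
Qed.

Lemma borel_caratheodory (A : set (borel Z)) : measurable A ->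
  outer_content.-caratheodory A.
Proof.
apply: smallest_sub; last by move=> U; exact: open_caratheodory.
split.
- exact: caratheodory_measurable_set0.
- by move=> B mB; rewrite setTD; exact: caratheodory_measurable_setC.
- by move=> F mF; exact: caratheodory_measurable_bigcup.
Qed.

(** A separate constant on [borel Z] to carry the measure instances; [outer_content] itself carries
    the outer measure instance. *)
Definition content_measure (A : set (borel Z)) : \bar R := outer_content A.

Lemma content_measure_sigma_additive : semi_sigma_additive content_measure.
Proof.
move=> F mF tF mUF.
exact: (@caratheodory_measure_sigma_additive R Z outer_content F
  (fun i => borel_caratheodory _ (mF i)) tF (borel_caratheodory _ mUF)).
Qed.

HB.instance Definition _ := isMeasure.Build _ (borel Z) R content_measure
  outer_content0 outer_content_ge0 content_measure_sigma_additive.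

(** Tightness enters here: [inner_content] sees only compact sets, and tightness prevents mass from
    escaping them. *)
Lemma content_measureT : content_measure setT = 1.
Proof.
rewrite /content_measure outer_content_open; last exact: topology_structure.openT.
apply/eqP; rewrite eq_le; apply/andP; split.
  by apply: le_trans (inner_content_le _) _; rewrite gaT.
apply/lee_addgt0Pr => e e0; have [K cK Ke] := ga_tight _ e0.
apply: (@le_trans _ _ ((ga K)%:E + e%:E)); last first.
  by rewrite leeD2r//; exact: inner_content_ub.
by rewrite -EFinD lee_fin -gaT -(setUCr K) gaD ?setICr// lerD2l.
Qed.

HB.instance Definition _ :=
  Measure_isProbability.Build _ (borel Z) R content_measure content_measureT.

Lemma content_measure_le (U : set Z) : open U -> content_measure U <= (ga U)%:E.
Proof.
by move=> oU; rewrite /content_measure outer_content_open// inner_content_le.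
Qed.

Lemma content_measure_radon : radon content_measure.
Proof.
move=> A mA; apply/eqP; rewrite eq_le; apply/andP; split; last first.
  apply: ge_ereal_sup => _ [K [_ KA] <-]; exact: outer_contentS.
apply/lee_addgt0Pr => e e0; have e2 : (0 < e / 2)%R by lra.
have [U [oU AU UA]] := outer_content_adherent (~` A) _ e2.
have [K cK Ke] := ga_tight _ e2.
have clK : closed K by exact: compact_closed.
have mU := measurable_open_borel _ _ oU.
have mK := measurable_closed_borel _ _ clK.
pose L := K `\` U.
have cL : compact L.
  apply: (subclosed_compact _ cK) => [|x []//].
  by apply: closedI => //; exact: open_closedC.
have LA : L `<=` A by move=> x [_ Ux]; apply: contrapT => Ax; exact/Ux/AU.
apply: (@le_trans _ _ (content_measure L + e%:E)); last first.
  by rewrite leeD2r//; apply: ereal_sup_ubound; exists L.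
have mL : measurable (L : set (borel Z)) by exact: measurableD.
have CK : content_measure (~` K) <= (e / 2)%:E.
  apply: le_trans (content_measure_le _ _) _; first exact: closed_openC.
  by rewrite lee_fin.
have UA' : content_measure U <= 1 - content_measure A + (e / 2)%:E.
  rewrite -(probability_setC content_measure mA).
  by apply: le_trans UA; rewrite /content_measure outer_content_open.
have CL : content_measure (~` L) <= content_measure (~` K) + content_measure U.
  rewrite /L setDE setCI setCK; apply: measureU2 => //; exact: measurableC.
rewrite (probability_setC content_measure mL) in CL.
have {}CL : 1 - content_measure L <=
  content_measure (~` K) + content_measure U := CL.
move: CL UA' CK.
have : forall B, content_measure B \is a fin_num by exact: outer_content_fin.
move=> fB; move: (fB A) (fB L) (fB U) (fB (~` K)).
move: (content_measure A) (content_measure L) (content_measure U) (content_measure (~` K)).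
move=> [x| |]// [y| |]// [z| |]// [u| |]// _ _ _ _.
by rewrite -?EFinD -?EFinB !lee_fin => ? ? ?; lra.
Qed.

(** The one-sided comparison on open sets is enough later: total mass one turns it into equality of
    marginals, and open superlevel sets carry it to integrals of nonnegative bounded continuous
    functions. *)
Theorem radon_of_tight_content : exists P : probability (borel Z) R,
  radon P /\ forall U : set Z, open U -> P U <= (ga U)%:E.
Proof.
exists content_measure; split; [exact: content_measure_radon|].
exact: content_measure_le.
Qed.

End TightContent.

(** * Borel functions and regularity of Radon probabilities *)

Section BorelFunctions.
Context {R : realType}.

Lemma continuous_borel (S T : ptopologicalType) (f : S -> T) : continuous f ->
  measurable_fun setT (f : borel S -> borel T).
Proof.
move=> /continuousP cf.
apply: (@measurability _ _ (borel S) (borel T) setT f (@open T)) => //.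
move=> _ [U oU <-].
by rewrite setTI; apply: measurable_open_borel; exact: cf.
Qed.

Lemma continuous_borel_real (T : ptopologicalType) (f : T -> R) : continuous f ->
  measurable_fun setT (f : borel T -> R).
Proof.
move=> /continuousP cf; apply: (measurability _ (RGenOpens.measurableE R)).
move=> _ [U [a [b ->]] <-]; rewrite setTI; apply: measurable_open_borel.
by apply: cf; exact: itv_open.
Qed.

Lemma bounded_probability_integrable d (T : measurableType d)
    (P : probability T R) (f : T -> R) :
  measurable_fun setT f -> bdd f -> P.-integrable setT (EFin \o f).
Proof.
move=> mf [M fM]; apply: measurable_bounded_integrable => //.
  by apply: le_lt_trans (probability_le1 _ _) (ltry _).
by exists M; split; [exact: num_real|move=> N MN x _; exact: le_trans (fM x) (ltW MN)].
Qed.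

(** The complement rule turns the second inequality into the reverse of the first. [P] and [Q] are
    bare set functions, so the image of a probability under a map fits directly. *)
Lemma eq_probability_of_le d (T : measurableType d) (P Q : set T -> \bar R)
    (A : set T) : P A \is a fin_num -> Q A \is a fin_num ->
  P (~` A) = (1 - P A)%E -> Q (~` A) = (1 - Q A)%E ->
  (P A <= Q A)%E -> (P (~` A) <= Q (~` A))%E -> P A = Q A.
Proof.
move=> fP fQ -> ->; move: (P A) (Q A) fP fQ => [x| |]// [y| |]// _ _.
rewrite -!EFinB !lee_fin => ? ?; congr EFin; lra.
Qed.

(** [U] is the complement of a compact set that nearly fills the complement of [A]; it is open
    because compact sets are closed in a Hausdorff space. *)
Lemma radon_outer (X : ptopologicalType) (hX : hausdorff_space X)
    (mu : probability (borel X) R) (rmu : radon mu) (A : set (borel X)) (e : R) :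
  measurable A -> 0 < e ->
  exists U : set X, [/\ open U, A `<=` U & (mu U <= mu A + e%:E)%E].
Proof.
move=> mA e0; have mCA := measurableC mA.
have fmu B : measurable B -> mu B \is a fin_num by exact: fin_num_measure.
have fs := fmu _ mCA; rewrite (rmu _ mCA) in fs.
have [_ [K [cK KA] <-]] := ub_ereal_sup_adherent e0 fs.
rewrite -(rmu _ mCA) => /ltW Kge.
have clK : closed K by exact: compact_closed.
have mK : measurable (K : set (borel X)) by exact: measurable_closed_borel.
exists (~` K); split; first exact: closed_openC.
  by move=> x Ax /KA.
rewrite (probability_setC mu mK).
move: Kge; rewrite (probability_setC mu mA); move: (fmu _ mA) (fmu _ mK).
move: (mu A) (mu K) => [x| |]// [y| |]// _ _.
by rewrite -?EFinD -?EFinB !lee_fin => ?; lra.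
Qed.

Lemma radon_tight (X : ptopologicalType) (hX : hausdorff_space X)
    (mu : probability (borel X) R) (rmu : radon mu) (e : R) : 0 < e ->
  exists2 K : set X, compact K & (mu (~` K) <= e%:E)%E.
Proof.
move=> e0; have fs : mu setT \is a fin_num by exact: fin_num_measure.
rewrite (rmu _ measurableT) in fs.
have [_ [K [cK _] <-]] := ub_ereal_sup_adherent e0 fs.
rewrite -(rmu _ measurableT) probability_setT => /ltW Kge.
exists K => //.
have mK : measurable (K : set (borel X)).
  by apply: measurable_closed_borel; exact: compact_closed.
rewrite (probability_setC mu mK).
move: Kge (fin_num_measure mu _ mK); move: (mu K) => [x| |]// + _; last first.
  by rewrite addeNy leNye.
by rewrite -?EFinB !lee_fin => ?; lra.
Qed.

(* Domination on open sets gives domination on Borel sets by outer regularity,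
   and domination between probabilities is equality. *)
Lemma marginal_radon (X Z : ptopologicalType) (hX : hausdorff_space X)
    (mu : probability (borel X) R) (P : probability (borel Z) R) (f : Z -> X) :
  radon mu -> continuous f ->
  (forall U : set X, open U -> (P (f @^-1` U) <= mu U)%E) ->
  forall A : set (borel X), measurable A -> P (f @^-1` A) = mu A.
Proof.
move=> rmu cf Pmu A mA.
have mf B : measurable B -> measurable ((f : borel Z -> borel X) @^-1` B).
  by move=> mB; rewrite -[X in measurable X]setTI; exact: continuous_borel.
have le (B : set (borel X)) : measurable B -> (P (f @^-1` B) <= mu B)%E.
  move=> mB; apply/lee_addgt0Pr => e e0.
  have [U [oU BU UB]] := radon_outer _ hX _ rmu _ _ mB e0.
  apply: le_trans UB; apply: le_trans (Pmu _ oU).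
  apply: le_measure; rewrite ?inE; last exact: preimage_subset.
    exact: mf.
  by apply: mf; exact: measurable_open_borel.
apply: (@eq_probability_of_le _ (borel X) (fun B => P (f @^-1` B)) mu).
- by apply: fin_num_measure; exact: mf.
- exact: fin_num_measure.
- by rewrite preimage_setC (probability_setC P (mf _ mA)).
- exact: (probability_setC mu mA).
- exact: le.
- by apply: le; exact: measurableC.
Qed.

End BorelFunctions.

(** * Staircase approximation by open superlevel sets *)

Section Layers.
Context {R : realType} {Z : ptopologicalType}.

(** For [0 < d] and [0 <= f] this is [d] times the smaller of [n] and the ceiling of [f / d]. The
    strict inequality makes the superlevel sets open when [f] is continuous. *)
Definition layers (f : Z -> R) (d : R) (n : nat) : Z -> R :=
  \sum_(i < n) (d *: \1_[set z | i%:R * d < f z]).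

Lemma layersS f d n z :
  layers f d n.+1 z = layers f d n z + d * (n%:R * d < f z)%R%:R.
Proof.
rewrite /layers big_ord_recr/= -[LHS]/(_ z + d *: \1_[set z | n%:R * d < f z] z).
rewrite indicE; congr (_ + d * _%:R).
by congr nat_of_bool; apply/idP/idP; rewrite inE.
Qed.

(** The bounds are proved together: when [n d < f z], the first one leaves room below [f z + d] for
    one more layer. *)
Lemma layers_bounds (f : Z -> R) (d : R) n z : 0 <= d -> 0 <= f z ->
  [/\ layers f d n z <= n%:R * d, layers f d n z <= f z + d &
      Num.min (f z) (n%:R * d) <= layers f d n z].
Proof.
move=> d0 f0; elim: n => [|n [IH1 IH2 IH3]].
  by rewrite /layers big_ord0 /= mul0r; split=> //; rewrite ?addr_ge0// ge_min lexx orbT.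
rewrite layersS -natr1 mulrDl mul1r.
case: ltP => nf; rewrite /= ?mulr1 ?mulr0 ?addr0.
  split; rewrite ?lerD2r//; first exact: le_trans IH1 (ltW nf).
  move: IH3; rewrite (min_idPr (ltW nf)) ge_min => ?.
  by rewrite lerD2r orbC; apply/orP; left.
split=> //; first by apply: le_trans IH1 _; rewrite lerDl.
by move: IH3; rewrite (min_idPl nf) ge_min => ->.
Qed.

End Layers.

Section LayerIntegral.
Context {R : realType} {Z : ptopologicalType}.

Lemma open_superlevel (f : Z -> R) (a : R) : continuous f ->
  open [set z | a < f z].
Proof. by move=> /continuousP cf; exact: (cf _ (@open_gt R a)). Qed.

Lemma bdd_layers (f : Z -> R) d n : bdd (layers f d n).
Proof.
elim: n => [|n IH]; first by rewrite /layers big_ord0; exact: bdd_cst.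
by rewrite /layers big_ord_recr/=; apply: bddD => //; apply: bddZ; exact: bdd_indic.
Qed.

Lemma measurable_layers (f : Z -> R) d n : continuous f ->
  measurable_fun setT (layers f d n : borel Z -> R).
Proof.
move=> cf; elim: n => [|n IH]; first by rewrite /layers big_ord0; exact: measurable_cst.
rewrite /layers big_ord_recr/=; apply: measurable_funD => //.
apply: measurable_funM; first exact: measurable_cst.
by apply: measurable_indic; apply: measurable_open_borel; exact: open_superlevel.
Qed.

(* [f] lies within [d] of its layers, which are combinations of indicators of
   open sets. *)
Lemma integral_le_of_open_le (P : probability (borel Z) R) (L : (Z -> R) -> R)
    (LD : forall h k, bdd h -> bdd k -> L (h + k) = L h + L k)
    (LZ : forall (t : R) h, 0 <= t -> bdd h -> L (t *: h) = t * L h)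
    (Lle : forall h k, bdd h -> bdd k -> (forall z, h z <= k z) -> L h <= L k)
    (L1 : L (cst 1) = 1)
    (PL : forall U : set Z, open U -> (P U <= (L \1_U)%:E)%E) (f : Z -> R) :
  (forall z, 0 <= f z) -> bdd f -> continuous f ->
  (\int[P]_z (f z)%:E <= (L f)%:E)%E.
Proof.
move=> f0 bf cf; apply/lee_addgt0Pr => d d0.
have [M fM] := bf.
(* Once [n d] exceeds the bound of [f], the minimum in [layers_bounds] is [f] itself, so the layers
   dominate [f]. *)
have [n Mn] : exists n, M <= n%:R * d.
  exists (Num.truncn (M / d)).+1; rewrite -ler_pdivrMr//; exact/ltW/truncnS_gt.
have lay m z := layers_bounds f d m z (ltW d0) (f0 z).
have mlay m : measurable_fun setT (layers f d m : borel Z -> R).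
  exact: measurable_layers.
have lay0 m z : 0 <= layers f d m z.
  have [_ _] := lay m z; apply: le_trans.
  by rewrite le_min f0/= mulr_ge0// (ltW d0).
have layL m : (\int[P]_z (layers f d m z)%:E <= (L (layers f d m))%:E)%E.
  elim: m => [|m IH].
    rewrite integral0_eq => [|z _]; last by rewrite /layers big_ord0.
    have -> : layers f d 0 = 0 *: cst 1.
      by rewrite /layers big_ord0 scale0r.
    by rewrite LZ ?mul0r//; exact: bdd_cst.
  have oU : open [set z | m%:R * d < f z] by exact: open_superlevel.
  have mU := measurable_open_borel _ _ oU.
  have lE z : ((layers f d m.+1 z)%:E =
      (layers f d m z)%:E + (d%:E * (\1_[set z | m%:R * d < f z] z)%:E))%E.
    by rewrite /layers big_ord_recr.
  under eq_integral do rewrite lE.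
  rewrite ge0_integralD//; first last.
  - by apply/measurable_EFinP; apply: measurable_funM => //; exact: measurable_indic.
  - by move=> z _; rewrite -EFinM lee_fin mulr_ge0 ?(ltW d0)// indicE.
  - by apply/measurable_EFinP.
  - by move=> z _; rewrite lee_fin.
  rewrite ge0_integralZl//; first last.
  - by rewrite lee_fin ltW.
  - by apply/measurable_EFinP; exact: measurable_indic.
  rewrite integral_indic// setIT.
  have -> : layers f d m.+1 = layers f d m + d *: \1_[set z | m%:R * d < f z].
    by rewrite /layers big_ord_recr.
  rewrite LD ?LZ ?(ltW d0)//; first last.
  - by apply: bddZ; exact: bdd_indic.
  - exact: bdd_layers.
  - exact: bdd_indic.
  rewrite EFinD EFinM; apply: leeD => //.
  by apply: lee_wpmul2l; [rewrite lee_fin ltW|exact: PL].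
apply: (@le_trans _ _ (\int[P]_z (layers f d n z)%:E)%E).
  apply: ge0_le_integral => //.
  - by move=> z _; rewrite lee_fin.
  - by apply/measurable_EFinP; exact: continuous_borel_real.
  - by apply/measurable_EFinP.
  - move=> z _; rewrite lee_fin; have [_ _] := lay n z.
    by rewrite (min_idPl _)//; apply: le_trans Mn; apply: le_trans (fM z); exact: ler_norm.
apply: le_trans (layL n) _; rewrite -EFinD lee_fin.
(* The layers exceed [f] by at most [d], and [L (cst 1) = 1] prices the constant [d] at exactly
   [d]. *)
have -> : L f + d = L (f + d *: cst 1).
  by rewrite LD ?LZ ?L1 ?mulr1 ?(ltW d0)//; [exact: bdd_cst|apply: bddZ; exact: bdd_cst].
apply: Lle; [exact: bdd_layers|apply: bddD => //; apply: bddZ; exact: bdd_cst|].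
move=> z; change (layers f d n z <= f z + d * 1); rewrite mulr1.
by have [] := lay n z.
Qed.

End LayerIntegral.

(** * c-transforms *)

Section CTransform.
Context {R : realType}.

(** [phi'] is the c-transform [inf_y (f x y - psi y)], the largest partner of [psi]. The modulus of
    continuity of [f] in [x] is uniform in [y], hence survives the infimum. Currying [f] lets either
    variable come first. *)
Lemma c_transform_half (X Y : ptopologicalType) (f : X -> Y -> R)
    (phi : X -> R) (psi : Y -> R) :
  (exists M, forall x y, `|f x y| <= M) -> bdd psi ->
  (forall x0 (e : R), 0 < e ->
     \forall x \near x0, forall y, `|f x y - f x0 y| <= e) ->
  (forall x y, phi x + psi y <= f x y) ->
  exists phi', [/\ Cb phi', forall x, phi x <= phi' x &
    forall x y, phi' x + psi y <= f x y].
Proof.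
move=> [M fM] [N psiN] fc le.
pose S x := [set f x y - psi y | y in setT].
have Sle x y : - (M + N) <= f x y - psi y <= M + N.
  have := fM x y; have := psiN y; rewrite !ler_norml => /andP[? ?] /andP[? ?].
  by apply/andP; split; lra.
pose phi' x := inf (S x).
have p'le x y : phi' x <= f x y - psi y.
  apply: ge_inf; last by exists y.
  by exists (- (M + N)) => _ [y' _ <-]; have /andP[] := Sle x y'.
have p'ge x m : (forall y, m <= f x y - psi y) -> m <= phi' x.
  move=> mle; apply: lb_le_inf; first by exists (f x point - psi point), point.
  by move=> _ [y _ <-].
have p'near x x' e : (forall y, `|f x y - f x' y| <= e) -> phi' x' - e <= phi' x.
  move=> xe; apply: (p'ge) => y; have := p'le x' y; have := xe y.
  by rewrite ler_norml => /andP[? ?] ?; lra.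
exists phi'; split.
- split.
    move=> x0; apply/cvgrPdist_le => e e0; have := fc x0 e e0.
    apply: filterS => x xe; rewrite ler_norml; apply/andP; split.
      by rewrite lerNl opprB lerBlDr -lerBlDl; apply: (p'near) => y; rewrite distrC.
    by rewrite lerBlDr -lerBlDl; exact: p'near.
  exists (M + N) => x; rewrite ler_norml; apply/andP; split.
    by apply: (p'ge) => y; have /andP[] := Sle x y.
  by apply: le_trans (p'le x point) _; have /andP[] := Sle x point.
- by move=> x; apply: (p'ge) => y; rewrite lerBrDr.
- by move=> x y; rewrite -lerBrDr.
Qed.

(** Stated for the bare supremum, to which both [dbar] and [dunder] unfold. *)
Lemma dist_sup_near (S T : topologicalType) (f : S -> T -> R) (x0 : S) (e : R) :
  ereal_sup [set (`|f x y - f x0 y|)%:E | y in [set: T]] @[x --> x0] --> 0%E ->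
  0 < e -> \forall x \near x0, forall y, `|f x y - f x0 y| <= e.
Proof.
move=> H e0; have n0 : nbhs (0%E : \bar R) [set y | (y < e%:E)%E].
  by apply: open_nbhs_nbhs; split; [exact: open_ereal_lt_ereal|rewrite /= lte_fin].
have {H n0} : \forall x \near x0,
    (ereal_sup [set (`|f x y - f x0 y|)%:E | y in [set: T]] < e%:E)%E by exact: (H _ n0).
apply: filterS => x xe y; rewrite -lee_fin; apply: le_trans (ltW xe).
by apply: ereal_sup_ubound; exists y.
Qed.

(** Two half steps: [phi] is improved against [psi], then [psi] against the new [phi'], which is
    bounded by then. Both potentials only grow, so the dual value does not drop. *)
Lemma c_transform (X Y : ptopologicalType) (f : X * Y -> R)
    (phi : X -> R) (psi : Y -> R) :
  propH f -> bdd f -> bdd psi -> (forall x y, phi x + psi y <= f (x, y)) ->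
  exists phi' psi', [/\ Cb phi', Cb psi', forall x, phi x <= phi' x,
    forall y, psi y <= psi' y & forall x y, phi' x + psi' y <= f (x, y)].
Proof.
move=> [fX fY] [M fM] bpsi le.
have [||phi' [Cphi' phile phi'le]] :=
    @c_transform_half X Y (fun x y => f (x, y)) phi psi _ bpsi _ le.
- by exists M => x y; exact: fM.
- by move=> x0 e e0; apply: dist_sup_near => //; exact: fX.
have [|||psi' [Cpsi' psile psi'le]] :=
    @c_transform_half Y X (fun y x => f (x, y)) psi phi' _ Cphi'.2 _ _.
- by exists M => y x; exact: fM.
- by move=> y0 e e0; apply: (@dist_sup_near Y X (fun y x => f (x, y))) => //; exact: fY.
- by move=> y x; rewrite addrC.
exists phi', psi'; split=> // x y; by rewrite addrC.
Qed.

(** The increment is split at [f (x0, y)]: the change in [x] is small uniformly in [y], and the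
    change in [y] is then taken at [x0]. *)
Lemma propH_continuous (X Y : topologicalType) (f : X * Y -> R) :
  propH f -> continuous f.
Proof.
move=> [fX fY] [x0 y0]; apply/cvgrPdist_le => e e0.
have e2 : 0 < e / 2 by lra.
have nx := dist_sup_near _ _ (fun x y => f (x, y)) x0 _ (fX x0) e2.
have ny := dist_sup_near _ _ (fun y x => f (x, y)) y0 _ (fY y0) e2.
exists ([set x | forall y, `|f (x, y) - f (x0, y)| <= e / 2],
        [set y | forall x, `|f (x, y) - f (x, y0)| <= e / 2]); first by split.
move=> [x y] /= [/(_ y) hx /(_ x0) hy].
rewrite distrC -(subrKA (f (x0, y))); apply: le_trans (ler_normD _ _) _.
by rewrite [leRHS](splitr e) lerD.
Qed.

End CTransform.

(** * Couplings *)

Section BoundedMeasurable.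
Context {R : realType} {d : measure_display} {T : measurableType d}.

Definition bounded_measurable (f : T -> R) := measurable_fun setT f /\ bdd f.

Lemma bounded_measurableD f g : bounded_measurable f -> bounded_measurable g ->
  bounded_measurable (f + g).
Proof.
by move=> [mf bf] [mg bg]; split; [exact: measurable_funD|exact: bddD].
Qed.

Lemma bounded_measurableZ t f : bounded_measurable f ->
  bounded_measurable (t *: f).
Proof.
by move=> [mf bf]; split; [apply: measurable_funM => //; exact: measurable_cst|exact: bddZ].
Qed.

Lemma bounded_measurable_cst (M : R) : bounded_measurable (cst M).
Proof. by split; [exact: measurable_cst|exact: bdd_cst]. Qed.

Lemma bounded_measurable_indic A : measurable A -> bounded_measurable \1_A.
Proof. by move=> mA; split; [exact: measurable_indic|exact: bdd_indic]. Qed.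

Variable P : probability T R.

Definition expect (f : T -> R) : R := \int[P]_x f x.

Lemma bounded_measurable_integrable f : bounded_measurable f ->
  P.-integrable setT (EFin \o f).
Proof. by move=> [mf bf]; exact: bounded_probability_integrable. Qed.

Lemma EFin_expect f : bounded_measurable f ->
  (expect f)%:E = (\int[P]_x (f x)%:E)%E.
Proof.
move=> bf; rewrite /expect /Rintegral fineK//.
by apply: integrable_fin_num => //; exact: bounded_measurable_integrable.
Qed.

Lemma expectD f g : bounded_measurable f -> bounded_measurable g ->
  expect (f + g) = expect f + expect g.
Proof.
by move=> bf bg; apply: RintegralD => //; exact: bounded_measurable_integrable.
Qed.

Lemma expectZ t f : bounded_measurable f -> expect (t *: f) = t * expect f.
Proof.
by move=> bf; apply: RintegralZl => //; exact: bounded_measurable_integrable.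
Qed.

Lemma expect_cst M : expect (cst M) = M.
Proof.
rewrite /expect Rintegral_cst// (_ : fine _ = 1) ?mulr1//.
by rewrite -[RHS]/(fine 1%E); congr fine; exact: probability_setT.
Qed.

Lemma expect_indic A : measurable A -> (expect \1_A)%:E = P A.
Proof.
move=> mA; rewrite EFin_expect; last exact: bounded_measurable_indic.
by rewrite integral_indic// setIT.
Qed.

Lemma expect_le f g : bounded_measurable f -> bounded_measurable g ->
  (forall x, f x <= g x) -> expect f <= expect g.
Proof.
by move=> bf bg fg; apply: le_Rintegral => //; exact: bounded_measurable_integrable.
Qed.

End BoundedMeasurable.

Lemma Cb_bounded_measurable {R : realType} (T : ptopologicalType) (f : T -> R) :
  Cb f -> @bounded_measurable R _ (borel T) f.
Proof. by move=> [cf bf]; split=> //; exact: continuous_borel_real. Qed.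

Lemma hausdorff_prod (X Y : topologicalType) :
  hausdorff_space X -> hausdorff_space Y -> hausdorff_space (X * Y)%type.
Proof.
move=> hX hY [x y] [x' y'] xy; congr pair; [apply: hX|apply: hY] => A B nA nB.
  have nbX (z : X) (w : Y) (C : set X) : nbhs z C -> nbhs (z, w) (C `*` setT).
    by move=> nC; exists (C, setT) => //; split=> //; exact: filterT.
  have [[a b] [[/= Aa _] [/= Ba _]]] := xy _ _ (nbX _ y _ nA) (nbX _ y' _ nB).
  by exists a.
have nbY (z : X) (w : Y) (C : set Y) : nbhs w C -> nbhs (z, w) (setT `*` C).
  by move=> nC; exists (setT, C) => //; split=> //; exact: filterT.
have [[a b] [[/= _ Ab] [/= _ Bb]]] := xy _ _ (nbY x _ _ nA) (nbY x' _ _ nB).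
by exists b.
Qed.

(** * Couplings from finitely additive contents, and weak duality *)

Section Coupling.
Context {R : realType} {X Y : ptopologicalType}.
Variables (mu : probability (borel X) R) (nu : probability (borel Y) R).
Local Notation bmX := (@bounded_measurable R _ (borel X)).
Local Notation bmY := (@bounded_measurable R _ (borel Y)).

(** Tightness of [ga] comes from its marginals: the complement of a product of compact sets is
    covered by two cylinders of small content. The measure obtained is compared with [ga] on open
    sets only, and [marginal_radon] upgrades this to equality of marginals. *)
Theorem coupling_of_content (ga : set (X * Y) -> R) :
  hausdorff_space X -> hausdorff_space Y -> radon mu -> radon nu ->
  (forall A, 0 <= ga A) ->
  (forall A B, A `&` B = set0 -> ga (A `|` B) = ga A + ga B) ->
  (forall A : set (borel X), measurable A -> (ga (fst @^-1` A))%:E = mu A) ->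
  (forall B : set (borel Y), measurable B -> (ga (snd @^-1` B))%:E = nu B) ->
  exists g : probability (borel (X * Y)%type) R,
    coupling mu nu g /\ forall U, open U -> (g U <= (ga U)%:E)%E.
Proof.
move=> hX hY rmu rnu ga0 gaD gaX gaY.
have hXY := hausdorff_prod X Y hX hY.
have gaT : ga setT = 1.
  by apply: EFin_inj; rewrite -(probability_setT mu) -gaX// preimage_setT.
have tight (e : R) : 0 < e ->
    exists2 K : set (X * Y), compact K & ga (~` K) <= e.
  move=> e0; have e2 : 0 < e / 2 by lra.
  have [K cK Ke] := radon_tight _ hX mu rmu _ e2.
  have [L cL Le] := radon_tight _ hY nu rnu _ e2.
  exists (K `*` L); first exact: compact_setX.
  have mK : measurable (~` K : set (borel X)).
    by apply: measurableC; apply: measurable_closed_borel; exact: compact_closed.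
  have mL : measurable (~` L : set (borel Y)).
    by apply: measurableC; apply: measurable_closed_borel; exact: compact_closed.
  rewrite -(gaX _ mK) lee_fin in Ke; rewrite -(gaY _ mL) lee_fin in Le.
  apply: (@le_trans _ _ (ga (fst @^-1` (~` K) `|` snd @^-1` (~` L)))).
    apply: (contentS _ ga0 gaD) => -[x y] /= nKL.
    by have [Kx|] := pselect (K x); [right => Ly; exact: nKL|left].
  apply: le_trans (contentU _ ga0 gaD _ _) _.
  by rewrite (splitr e) lerD.
have [g [rg gle]] := radon_of_tight_content hXY ga ga0 gaD gaT tight.
exists g; split=> //; split=> // A mA.
  have -> : A `*` setT = fst @^-1` A :> set (X * Y).
    by apply/seteqP; split=> -[x y] //= [].
  apply: (@marginal_radon R X (X * Y)%type hX mu g fst rmu) => //.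
    by move=> z; exact: cvg_fst.
  move=> U oU; rewrite -gaX; last exact: measurable_open_borel.
  by apply: gle; apply: open_comp => // z _; exact: cvg_fst.
have -> : setT `*` A = snd @^-1` A :> set (X * Y).
  by apply/seteqP; split=> -[x y] //= [].
apply: (@marginal_radon R Y (X * Y)%type hY nu g snd rnu) => //.
  by move=> z; exact: cvg_snd.
move=> U oU; rewrite -gaY; last exact: measurable_open_borel.
by apply: gle; apply: open_comp => // z _; exact: cvg_snd.
Qed.

(* Hahn-Banach applied to the cone of functions superreplicated by
   [phi (+) psi + t (c n - D)] yields a positive functional with the prescribed
   marginals that prices every [c n] at most [D]; restricted to indicators it is
   the content from which the coupling is built. *)
Theorem exists_coupling_le (c : nat -> X * Y -> R) (D : R) :
  hausdorff_space X -> hausdorff_space Y -> radon mu -> radon nu ->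
  (forall n, continuous (c n)) -> (forall n, bdd (c n)) ->
  (forall n z, 0 <= c n z) -> (forall n z, c n z <= c n.+1 z) ->
  (forall n phi psi, bmX phi -> bmY psi ->
    (forall x y, phi x + psi y <= c n (x, y)) ->
    expect mu phi + expect nu psi <= D) ->
  exists g : probability (borel (X * Y)%type) R,
    coupling mu nu g /\ forall n, (\int[g]_z (c n z)%:E <= D%:E)%E.
Proof.
move=> hX hY rmu rnu cc cb c0 cS cD.
have cmono m n z : (m <= n)%N -> c m z <= c n z.
  by move=> mn; apply: (nondecreasing_seqP (c ^~ z)).1 => // k; exact: cS.
(* Multiples of [c n - D] are free of charge, which forces [L (c n) <= D]. One index suffices: since
   the [c n] increase, two witnesses combine at the larger index. *)
pose C (h : X * Y -> R) (r : R) := exists phi psi t n,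
  [/\ bmX phi, bmY psi, 0 <= t, expect mu phi + expect nu psi = r &
    forall z, h z <= phi z.1 + psi z.2 + t * (c n z - D)].
have CD h k r s : C h r -> C k s -> C (h + k) (r + s).
  move=> [p [q [t [n [bp bq t0 <- hle]]]]] [p' [q' [t' [n' [bp' bq' t0' <- kle]]]]].
  exists (p + p'), (q + q'), (t + t'), (maxn n n'); split.
  - exact: bounded_measurableD.
  - exact: bounded_measurableD.
  - exact: addr_ge0.
  - by rewrite !expectD//; lra.
  - move=> z.
    have := hle z; have := kle z.
    have := ler_wpM2l t0 (lerB (cmono n _ z (leq_maxl n n')) (lexx D)).
    have := ler_wpM2l t0' (lerB (cmono n' _ z (leq_maxr n n')) (lexx D)).
    change ((h + k) z) with (h z + k z); change ((p + p') z.1) with (p z.1 + p' z.1).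
    change ((q + q') z.2) with (q z.2 + q' z.2).
    by rewrite mulrDl => ? ? ? ?; lra.
have CZ (t : R) h r : 0 < t -> C h r -> C (t *: h) (t * r).
  move=> t0 [p [q [s [n [bp bq s0 <- hle]]]]].
  exists (t *: p), (t *: q), (t * s), n; split.
  - exact: bounded_measurableZ.
  - exact: bounded_measurableZ.
  - by rewrite mulr_ge0// ltW.
  - by rewrite !expectZ// mulrDr.
  - move=> z; change (t * h z <= t * p z.1 + t * q z.2 + t * s * (c n z - D)).
    by rewrite -mulrA -!mulrDr ler_pM2l.
have Cle h k r : (forall z, h z <= k z) -> C k r -> C h r.
  move=> hk [p [q [s [n [bp bq s0 Er kle]]]]]; exists p, q, s, n; split=> // z.
  exact: le_trans (hk z) (kle z).
have Cpq p q r : bmX p -> bmY q -> expect mu p + expect nu q = r ->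
    C (fun z => p z.1 + q z.2) r.
  by move=> bp bq Er; exists p, q, 0, 0%N; split=> // z; rewrite mul0r addr0.
have C1 M : C (cst M) M.
  apply: Cle (Cpq (cst M) (cst 0) M _ _ _) => [z||| ] /=.
  - by rewrite addr0.
  - exact: bounded_measurable_cst.
  - exact: bounded_measurable_cst.
  - by rewrite !expect_cst addr0.
have C0 r : C (cst 0) r -> 0 <= r.
  move=> [p [q [t [n [bp bq t0 <- le]]]]].
  (* From [0 <= p + q + t (c n - D)] and [t c n <= s c n], the potentials [(t D - p) / s] and
     [- q / s] lie below [c n], so [cD] bounds their value by [D]. Dividing by [s] instead of [t]
     keeps the case [t = 0]. *)
  have sle s : 0 < s -> t <= s -> (t - s) * D <= expect mu p + expect nu q.
    move=> s0 ts.
    have bp' : bmX (- s^-1 *: p + cst (t / s * D)).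
      by apply: bounded_measurableD; [exact: bounded_measurableZ|exact: bounded_measurable_cst].
    have bq' : bmY (- s^-1 *: q) by exact: bounded_measurableZ.
    have := cD n _ _ bp' bq' _.
    rewrite expectD//; [|exact: bounded_measurableZ|exact: bounded_measurable_cst].
    rewrite expect_cst !expectZ// => H.
    have {H} : - s^-1 * expect mu p + t / s * D + - s^-1 * expect nu q <= D.
      apply: H => x y; have /= := le (x, y).
      change ((- s^-1 *: p + cst (t / s * D)) x + (- s^-1 *: q) y) with
        (- s^-1 * p x + t / s * D + - s^-1 * q y) => le0.
      have -> : - s^-1 * p x + t / s * D + - s^-1 * q y =
        (t * D - p x - q y) / s by field; rewrite gt_eqF.
      rewrite ler_pdivrMr//.
      have := ler_wpM2r (c0 n (x, y)) ts; lra.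
    have -> : - s^-1 * expect mu p + t / s * D + - s^-1 * expect nu q =
      (t * D - expect mu p - expect nu q) / s by field; rewrite gt_eqF.
    by rewrite ler_pdivrMr// => ?; lra.
  (* For [0 < t] take [s = t]. For [t = 0] let [s] shrink: [s = e / (|D| + 1)] ensures [s D <= e],
     also when [D = 0]. *)
  move: t0; rewrite le_eqVlt => /predU1P[t0|t0]; last first.
    by have := sle t t0 (lexx t); rewrite subrr mul0r.
  apply/ler_addgt0Pr => e e0.
  have d0 : 0 < e / (`|D| + 1) by rewrite divr_gt0// ltr_wpDl.
  have := sle _ d0; rewrite -t0 ltW// => /(_ isT); rewrite sub0r.
  have : e / (`|D| + 1) * D <= e.
    rewrite mulrAC ler_pdivrMr ?ltr_wpDl// ler_pM2l//.
    by apply: le_trans (ler_norm D) _; rewrite lerDl.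
  by lra.
have [L [LD LZ LC]] := exists_pricing C CD CZ Cle C1 C0.
have b1 := @bdd_cst R (X * Y)%type.
have LN h : bdd h -> L (- h) = - L h.
  move=> bh; have bN : bdd (- h) by rewrite -scaleN1r; exact: bddZ.
  have L0 : L (h + - h) = 0.
    by rewrite subrr -(scale0r (cst 1 : X * Y -> R)) LZ ?mul0r.
  by move: L0; rewrite LD// => ?; lra.
(* A separable function and its negative are both superreplicated at their own integrals, which pins
   down [L]. *)
have Lpq p q : bmX p -> bmY q -> bdd (fun z : X * Y => p z.1 + q z.2) ->
    L (fun z => p z.1 + q z.2) = expect mu p + expect nu q.
  move=> bp bq bb; apply/eqP; rewrite eq_le; apply/andP; split.
    by apply: LC => //; exact: Cpq.
  rewrite -lerN2 -LN//; apply: LC; first by rewrite -scaleN1r; exact: bddZ.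
  have bp' : bmX (-1 *: p) by exact: bounded_measurableZ.
  have bq' : bmY (-1 *: q) by exact: bounded_measurableZ.
  apply: Cle (Cpq _ _ _ bp' bq' _) => [z|]; last by rewrite !expectZ//; lra.
  change (- (p z.1 + q z.2) <= -1 * p z.1 + -1 * q z.2); lra.
have Lcst M : L (cst M) = M.
  have -> : cst M = fun z : X * Y => (cst M : X -> R) z.1 + (cst 0 : Y -> R) z.2.
    by apply/funext => z /=; rewrite addr0.
  rewrite Lpq ?expect_cst ?addr0//; try exact: bounded_measurable_cst.
  by exists `|M + 0|.
have Lle0 h k : bdd h -> bdd k -> (forall z, h z <= k z) -> L h <= L k.
  move=> bh bk hk; have bN : bdd (- k) by rewrite -scaleN1r; exact: bddZ.
  rewrite -subr_le0 -LN// -LD//; apply: LC; first exact: bddD.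
  by apply: Cle (C1 0) => z; change (h z - k z <= 0); rewrite subr_le0.
have bI E : bdd (\1_E : X * Y -> R) by exact: bdd_indic.
have [g [cg gle]] : exists g : probability (borel (X * Y)%type) R,
    coupling mu nu g /\ forall U, open U -> (g U <= (L \1_U)%:E)%E.
  apply: (coupling_of_content (fun E => L \1_E)) => //.
  - move=> A; have := Lle0 (cst 0) \1_A (b1 0) (bI A); rewrite Lcst; apply=> z.
    by rewrite /= indicE.
  - move=> A B AB; rewrite -LD//; congr L; apply/funext => z.
    change (\1_(A `|` B) z = \1_A z + \1_B z :> R); rewrite !indicE in_setU.
    have [zA|] := boolP (z \in A); have [zB|] := boolP (z \in B) => /=;
      rewrite ?addr0 ?add0r//.
    have ABz : (A `&` B) z by split; rewrite -in_setE.
    by rewrite AB in ABz.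
  - move=> A mA; rewrite -(expect_indic mu _ mA).
    have -> : \1_(fst @^-1` A) =
        fun z : X * Y => (\1_A : X -> R) z.1 + (cst 0 : Y -> R) z.2.
      by apply/funext => z /=; rewrite addr0 !indicE.
    rewrite Lpq ?expect_cst ?addr0//.
    + exact: bounded_measurable_indic.
    + exact: bounded_measurable_cst.
    + exists 1 => z /=; rewrite addr0 indicE.
      by case: (_ \in _); rewrite ?normr1 ?normr0.
  - move=> B mB; rewrite -(expect_indic nu _ mB).
    have -> : \1_(snd @^-1` B) =
        fun z : X * Y => (cst 0 : X -> R) z.1 + (\1_B : Y -> R) z.2.
      by apply/funext => z /=; rewrite add0r !indicE.
    rewrite Lpq ?expect_cst ?add0r//.
    + exact: bounded_measurable_cst.
    + exact: bounded_measurable_indic.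
    + exists 1 => z /=; rewrite add0r indicE.
      by case: (_ \in _); rewrite ?normr1 ?normr0.
exists g; split=> // n.
apply: (@le_trans _ _ (L (c n))%:E).
  exact: integral_le_of_open_le.
(* [c n - D] has price zero, with zero potentials and [t = 1]. *)
rewrite lee_fin -(Lcst D) -subr_le0 -LN// -LD//; last first.
  by rewrite -scaleN1r; exact: bddZ.
apply: LC; first by apply: bddD => //; rewrite -scaleN1r; exact: bddZ.
exists (cst 0), (cst 0), 1, n; split=> //.
- exact: bounded_measurable_cst.
- exact: bounded_measurable_cst.
- by rewrite !expect_cst addr0.
- by move=> z /=; rewrite !add0r mul1r.
Qed.

Lemma integral_marginal (T Z : ptopologicalType) (P : probability (borel T) R)
    (g : probability (borel Z) R) (f : Z -> T) (phi : T -> R) :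
  continuous f -> (forall A : set (borel T), measurable A -> g (f @^-1` A) = P A) ->
  Cb phi -> \int[g]_z phi (f z) = expect P phi.
Proof.
move=> cf gP Cphi; have [mphi bphi] := Cb_bounded_measurable _ _ Cphi.
have mf := continuous_borel _ _ _ cf.
rewrite /expect /Rintegral; congr fine.
have H := @integral_pushforward _ _ (borel Z) (borel T) R f mf g setT (EFin \o phi).
rewrite (eq_measure_integral (pushforward g (f : borel Z -> borel T))); last first.
  by move=> A mA _; symmetry; exact: gP.
rewrite H//.
- exact/measurable_EFinP.
- have [M pM] := bphi.
  apply: bounded_probability_integrable; last by exists M => z; exact: pM.
  exact: (measurableT_comp mphi mf).
Qed.

Lemma coupling_weak_duality (c : X * Y -> \bar R)
    (g : probability (borel (X * Y)%type) R) (phi : X -> R) (psi : Y -> R) :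
  coupling mu nu g -> measurable_fun setT (c : borel (X * Y)%type -> \bar R) ->
  (forall z, (0 <= c z)%E) -> Cb phi -> Cb psi ->
  (forall x y, ((phi x + psi y)%:E <= c (x, y))%E) ->
  ((expect mu phi + expect nu psi)%:E <= \int[g]_z c z)%E.
Proof.
move=> [_ gX gY] mc c0 Cphi Cpsi le.
have cf : continuous (fst : X * Y -> X) by move=> z; exact: cvg_fst.
have cs : continuous (snd : X * Y -> Y) by move=> z; exact: cvg_snd.
have gX' (A : set (borel X)) : measurable A -> g (fst @^-1` A) = mu A.
  by move=> mA; rewrite -gX//; congr (g _); apply/seteqP; split=> -[x y] //= [].
have gY' (A : set (borel Y)) : measurable A -> g (snd @^-1` A) = nu A.
  by move=> mA; rewrite -gY//; congr (g _); apply/seteqP; split=> -[x y] //= [].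
rewrite -(integral_marginal _ _ mu g _ _ cf gX' Cphi).
rewrite -(integral_marginal _ _ nu g _ _ cs gY' Cpsi).
have bm (T : ptopologicalType) (f : X * Y -> T) (u : T -> R) : continuous f ->
    Cb u -> @bounded_measurable R _ (borel (X * Y)%type) (u \o f).
  move=> ctf Cu; have [mu' [M uM]] := Cb_bounded_measurable _ _ Cu; split.
    exact: (measurableT_comp mu' (continuous_borel _ _ _ ctf)).
  by exists M => z; exact: uM.
have b1 := bm _ _ _ cf Cphi; have b2 := bm _ _ _ cs Cpsi.
pose s (z : X * Y) : R := phi z.1 + psi z.2.
have bS : @bounded_measurable R _ (borel (X * Y)%type) s.
  exact: bounded_measurableD b1 b2.
change ((expect g (phi \o fst) + expect g (psi \o snd))%:E <= \int[g]_z c z)%E.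
rewrite -expectD//; change ((expect g s)%:E <= \int[g]_z c z)%E.
(* [c] may be infinite or not integrable, so the comparison is between nonnegative functions: as
   [0 <= c], the positive part of [s] is still below [c]. *)
pose u z : R := Num.max (s z) 0.
have bu : @bounded_measurable R _ (borel (X * Y)%type) u.
  split; first by apply: measurable_maxr; [exact: bS.1|exact: measurable_cst].
  have [M bM] := bS.2; exists M => z; have := bM z; rewrite /u.
  by case: (leP (s z)) => _ bz //; rewrite normr0 (le_trans _ bz).
apply: (@le_trans _ _ (expect g u)%:E).
  by rewrite lee_fin; apply: expect_le => // z; rewrite /u le_max lexx.
rewrite EFin_expect//; apply: ge0_le_integral => //.
- by move=> z _; rewrite lee_fin /u le_max lexx orbT.
- by apply/measurable_EFinP; exact: bu.1.
- move=> [x y] _; rewrite /u; case: (leP (s _)) => _; first exact: c0.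
  exact: le.
Qed.

End Coupling.

(** * Equality of the primal and dual values *)

Theorem mainTheorem13 (R : realType) (X Y : ptopologicalType)
  (hX : hausdorff_space X) (pnX : perfectly_normal X)
  (hY : hausdorff_space Y) (pnY : perfectly_normal Y)
  (mu : probability (borel X) R) (nu : probability (borel Y) R)
  (rmu : radon mu) (rnu : radon nu)
  (c : X * Y -> \bar R) (hc : lsc_bi c)
  (hKP : (vKP mu nu c < +oo)%E)
  (cn : nat -> X * Y -> R)
  (cn_bd : forall n, exists M : R, forall z, `|cn n z| <= M)
  (cn_ge0 : forall n z, 0 <= cn n z)
  (cn_nd : forall n z, cn n z <= cn n.+1 z)
  (cn_lim : forall z, (cn n z)%:E @[n --> \oo] --> c z)
  (cn_H : forall n, propH (cn n)) :
  vDP mu nu c = vKP mu nu c.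
Proof.
have cc n : continuous (cn n) := propH_continuous _ _ _ (cn_H n).
have cmono z : {homo (fun n => (cn n z)%:E) : m n / (m <= n)%N >-> (m <= n)%E}.
  by apply: (nondecreasing_seqP _).1 => n; rewrite lee_fin.
have cnc n z : ((cn n z)%:E <= c z)%E.
  rewrite -(cvg_lim (@ereal_hausdorff R) (cn_lim z)); apply: lime_ge.
    by apply/cvg_ex; exists (c z); exact: cn_lim.
  by exists n => // m /= nm; exact: cmono.
have c0 z : (0 <= c z)%E by apply: le_trans (cnc 0%N z); rewrite lee_fin.
have mcn n : measurable_fun setT (EFin \o cn n : borel (X * Y)%type -> \bar R).
  by apply/measurable_EFinP; exact: continuous_borel_real.
have mc : measurable_fun setT (c : borel (X * Y)%type -> \bar R).
  apply: (@emeasurable_fun_cvg _ (borel (X * Y)%type) R setT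
    (fun n => EFin \o cn n)) => // z _.
  exact: cn_lim.
have dual (p : X -> R) (q : Y -> R) : Cb p -> Cb q ->
    (\int[mu]_x (p x)%:E + \int[nu]_y (q y)%:E)%E =
    (expect mu p + expect nu q)%:E.
  by move=> Cp Cq; rewrite EFinD !EFin_expect//; exact: Cb_bounded_measurable.
have weak : (vDP mu nu c <= vKP mu nu c)%E.
  apply: ge_ereal_sup => _ [[p q] [/= Cp Cq le] <-].
  apply: le_ereal_inf_tmp => _ [g cg <-]; rewrite dual//.
  exact: coupling_weak_duality.
apply/eqP; rewrite eq_le weak/=.
have D0 : (0 <= vDP mu nu c)%E.
  have C0 (T : ptopologicalType) : Cb (cst 0 : T -> R).
    by split; [exact: cst_continuous|exists 0 => x; rewrite normr0].
  apply: ereal_sup_ubound; exists (cst 0, cst 0) => /=.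
    by split=> // x y; rewrite addr0.
  by rewrite !integral0 adde0.
(* Zero potentials bound the dual value below, weak duality and [hKP] bound it above, so it can
   serve as the real number [D]. *)
have Dfin : vDP mu nu c \is a fin_num.
  by rewrite ge0_fin_numE//; exact: le_lt_trans hKP.
have [|g [cg gc]] := @exists_coupling_le R X Y mu nu cn (fine (vDP mu nu c))
  hX hY rmu rnu cc cn_bd cn_ge0 cn_nd.
  (* Borel potentials below [cn n] give way to continuous ones of no smaller value, admissible for
     [c] since [cn n <= c]. *)
  move=> n p q bp bq le.
  have [p' [q' [Cp Cq pp' qq' le']]] := c_transform _ _ _ _ _ (cn_H n) (cn_bd n) bq.2 le.
  have := Cb_bounded_measurable _ _ Cp; have := Cb_bounded_measurable _ _ Cq.
  move=> bq' bp'; apply: (@le_trans _ _ (expect mu p' + expect nu q')).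
    by apply: lerD; exact: expect_le.
  rewrite -lee_fin fineK// -dual//; apply: ereal_sup_ubound.
  exists (p', q') => //=; split=> // x y.
  by apply: le_trans (cnc n _); rewrite lee_fin.
apply: (@le_trans _ _ (\int[g]_z c z)%E); first by apply: ereal_inf_lbound; exists g.
rewrite -(fineK Dfin).
have -> : (\int[g]_z c z = \int[g]_z limn (fun n => (cn n z)%:E))%E.
  by apply: eq_integral => z _; apply/esym/cvg_lim => //; exact: cn_lim.
rewrite monotone_convergence//.
- apply: lime_le; last by apply: nearW.
  apply: ereal_nondecreasing_is_cvgn => m n mn; apply: ge0_le_integral => //.
  + by move=> z _; rewrite lee_fin.
  + exact: mcn.
  + exact: mcn.
  + by move=> z _; exact: cmono.
- by move=> n z _; rewrite lee_fin.
Qed.
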